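(* Let $X$ be a reflexive Banach space over $\mathbb R$, $\Lambda$ a directed set, $\{X_\lambda\}_{\lambda\in\Lambda}$ an upwards directed family of closed subspaces of $X$, and $V=\bigcup_{\lambda\in\Lambda}X_\lambda$. Suppose that $A:X\times V\longrightarrow\mathbb R$ is a function for which the following hold: (a) $A$ is of type $M$ with respect to $V$. (b) $\displaystyle\lim_{\|x\|\to\infty,\ x\in V}\frac{A(x,x)}{\|x\|}=\infty$. (c) $A_\lambda(x,\cdot)\in X_\lambda^*$ for all $\lambda\in\Lambda$ and all $x\in X_\lambda$, where $A_\lambda$ is the restriction of $A$ to $X_\lambda\times X_\lambda$. (d) The operator $T_\lambda:X_\lambda\longrightarrow X_\lambda^*$, defined by $\langle T_\lambda x,y\rangle=A_\lambda(x,y)$ for all $x,y\in X_\lambda$, is monotone and hemicontinuous, for all $\lambda\in\Lambda$. Then for each $v^*\in V^*$ there exists $x\in X$ such that $$A(x,v)=\langle v^*,v\rangle,\quad\text{for all } v\in V.$$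
   Context: All Banach spaces are over $\mathbb R$; $X^*$ denotes the dual of $X$ (the space of bounded linear functionals) and $\langle\cdot,\cdot\rangle$ the duality pairing. A family $\{X_\lambda\}_{\lambda\in\Lambda}$ of subspaces indexed by a directed set $\Lambda$ is upwards directed if $\lambda\leq\mu$ implies $X_\lambda\subseteq X_\mu$; hence $V$ is a linear subspace of $X$, equipped with the norm of $X$, and $V^*$ is the space of bounded linear functionals on $V$. Monotone and hemicontinuous: for a Banach space $Z$ and a (not necessarily linear) operator $T:Z\to Z^*$, $T$ is monotone if $\langle Tx-Ty,x-y\rangle\geq 0$ for all $x,y\in Z$; $T$ is hemicontinuous if, for all $x,y\in Z$, $T(x+ty)\to Tx$ weakly in $Z^*$ as $t\to 0^+$. Type $M$: let $X$ be a Banach space, $V$ a linear subspace of $X$ and $A:X\times V\to\mathbb R$ a function. $A$ is of type $M$ with respect to $V$ if, for any net $\{v_\lambda\}_{\lambda\in\Lambda}$ in $V$ (indexed by any directed set), any $x\in X$ and any $v^*\in V^*$, the three conditions (i) $v_\lambda\to x$ weakly in $X$, (ii) $A(v_\lambda,v)\to\langle v^*,v\rangle$ for all $v\in V$, (iii) $A(v_\lambda,v_\lambda)\to\langle\hat v^*,x\rangle$, where $\hat v^*$ is the (unique bounded linear) extension of $v^*$ to the closure of $V$, together imply that $A(x,v)=\langle v^*,v\rangle$ for all $v\in V$. (By (i), $x$ lies in the closure of $V$, so (iii) makes sense.) *)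

(* Defs.v *)
From HB Require Import structures.
From mathcomp Require Import all_boot all_order all_algebra.
From mathcomp Require Import all_classical all_reals all_analysis.

Set Implicit Arguments.
Unset Strict Implicit.
Unset Printing Implicit Defensive.

Import Order.TTheory GRing.Theory Num.Theory.
Import numFieldNormedType.Exports.

Local Open Scope classical_set_scope.
Local Open Scope ring_scope.

(* Directed sets are nonempty preordered sets in which every pair has an upper
   bound; antisymmetry is not required. *)
Definition directed (I : Type) (le : I -> I -> Prop) : Prop :=
  [/\ inhabited I,
      forall i, le i i,
      forall i j k, le i j -> le j k -> le i k
    & forall i j, exists k, le i k /\ le j k].

(* Convergence of a net [u : I -> T] to [l] is [u i @[i --> tails le] --> l]. *)
Definition tails (I : Type) (le : I -> I -> Prop) : set_system I :=
  filter_from setT (fun i => [set j | le i j]).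

Section duality.
Variables (R : realType) (X : normedModType R).
Implicit Types (W V : set X) (f g : X -> R).

(* Functions on a subspace W of X are represented by total functions on X whose
   values outside W are irrelevant: an element of the dual W^* is an f with
   [in_dual W f], two such f being the same functional when they agree on W. *)
Definition in_dual W f : Prop :=
  (forall (a : R) x y, W x -> W y -> f (a *: x + y) = a * f x + f y) /\
  exists C : R, forall x, W x -> `|f x| <= C * `|x|.

Definition dual_norm W f : R :=
  sup [set `|f x| | x in [set x | W x /\ `|x| <= 1]].

(* The bounded linear functionals on W^*. If f and g in W^* agree on W then
   [dual_norm W (f - g) = 0], so such a phi takes the same value at f and g. *)
Definition in_bidual W (phi : (X -> R) -> R) : Prop :=
  (forall (a : R) f g, in_dual W f -> in_dual W g ->
     phi (fun x => a * f x + g x) = a * phi f + phi g) /\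
  exists C : R, forall f, in_dual W f -> `|phi f| <= C * dual_norm W f.

(* The canonical embedding of X into its bidual is onto. *)
Definition reflexive_space : Prop :=
  forall phi, in_bidual setT phi ->
  exists x : X, forall f, in_dual setT f -> phi f = f x.

Definition weak_cvg (I : Type) (F : set_system I) (u : I -> X) (x : X) : Prop :=
  forall f, in_dual setT f -> f (u i) @[i --> F] --> f x.

(* Weak convergence in W^*, i.e. tested against W^**. *)
Definition dual_weak_cvg W (I : Type) (F : set_system I)
    (u : I -> X -> R) f : Prop :=
  forall phi, in_bidual W phi -> phi (u i) @[i --> F] --> phi f.

(* Operators T : W -> W^*, with [T x y] standing for <T x, y>. *)
Definition monotone_on W (T : X -> X -> R) : Prop :=
  forall x y, W x -> W y -> 0 <= T x (x - y) - T y (x - y).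

Definition hemicontinuous_on W (T : X -> X -> R) : Prop :=
  forall x y, W x -> W y ->
  dual_weak_cvg W (0 : R)^'+ (fun t => T (x + t *: y)) (T x).

(* vhat is the bounded linear extension of vs in V^* to the closure of V. *)
Definition closure_extension V (vs vhat : X -> R) : Prop :=
  in_dual (closure V) vhat /\ forall v, V v -> vhat v = vs v.

(* A : X * V -> R is represented by a total function on X * X whose values
   [A x y] with y outside V are irrelevant. *)
Definition type_M V (A : X -> X -> R) : Prop :=
  forall (I : Type) (le : I -> I -> Prop), directed le ->
  forall (v : I -> X), (forall i, V (v i)) ->
  forall (x : X) (vs vhat : X -> R),
    in_dual V vs -> closure_extension V vs vhat ->
    weak_cvg (tails le) v x ->
    (forall w, V w -> A (v i) w @[i --> tails le] --> vs w) ->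
    A (v i) (v i) @[i --> tails le] --> vhat x ->
  forall w, V w -> A x w = vs w.

(* The filter of [`|x| --> +oo]. *)
Definition norm_pinfty : set_system X :=
  filter_from setT (fun r : R => [set x | r < `|x|]).

Definition coercive_on V (A : X -> X -> R) : Prop :=
  A x x / `|x| @[x --> within V norm_pinfty] --> +oo.

End duality.

Arguments reflexive_space {R} X.

(* Main.v *)
(** Coercivity bounds, uniformly in l, the solutions x_l in X_l of
    A(x_l, y) = <v^*, y> (y in X_l). These exist by the Browder-Minty theorem,
    proved here without Brouwer's fixed point theorem: the inequalities
    <T y, y - x> >= 0 are affine in x, so for finitely many y a theorem of the
    alternative for affine functions on a convex set, whose multipliers are ruled
    out by monotonicity, solves them approximately in a ball; weak compactness
    gives an x good for all y, and Minty's trick concludes. Along an ultrafilter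
    finer than the tails of the directed set, the bounded family x_l converges
    weakly in the reflexive space X to some x; since A(x_l, x_l) = <v^*, x_l>,
    type M applies to a net generating this ultrafilter. *)
Require Import Defs.
From HB Require Import structures.
From mathcomp Require Import all_boot all_order all_algebra.
From mathcomp Require Import all_classical all_reals all_analysis.
From mathcomp Require Import ring lra.

Import Order.TTheory GRing.Theory Num.Theory.
Import numFieldNormedType.Exports.

Local Open Scope classical_set_scope.
Local Open Scope ring_scope.

(** * The Hahn-Banach theorem *)

Section HahnBanach.
Context {R : realType} {X : lmodType R} {p : X -> R}.
Hypothesis p_subadd : forall x y, p (x + y) <= p x + p y.
Hypothesis p_homog : forall (a : R) x, 0 < a -> p (a *: x) = a * p x.

(** Partial functionals are encoded by their graphs, so that Zorn's lemma applies to sets ordered by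
    inclusion. Single-valuedness follows from the domination by [p]. *)
Definition linear_graph_below (G : set (X * R)) : Prop :=
  [/\ G (0, 0),
      forall (a : R) x y r s, G (x, r) -> G (y, s) -> G (a *: x + y, a * r + s)
    & forall x r, G (x, r) -> r <= p x].

Lemma graph_scale {G} (a : R) x r :
  linear_graph_below G -> G (x, r) -> G (a *: x, a * r).
Proof. by case=> G0 GL _ Gx; have := GL a _ _ _ _ Gx G0; rewrite !addr0. Qed.

Lemma graph_functional {G} x r s :
  linear_graph_below G -> G (x, r) -> G (x, s) -> r = s.
Proof.
case=> G0 GL Gp Gr Gs.
have p0 : p 0 = 0 by have := p_homog 2 0 (ltr0Sn _ 1); rewrite scaler0; lra.
have := Gp _ _ (GL (-1) _ _ _ _ Gr Gs); have := Gp _ _ (GL (-1) _ _ _ _ Gs Gr).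
by rewrite scaleN1r addNr p0; lra.
Qed.

(** A value [c] at [x0] must satisfy [r - p (x - x0) <= c <= p (y + x0) - s] for all [(x, r)] and
    [(y, s)] in [G]. Subadditivity puts each lower bound below each upper one, and homogeneity
    reduces all multiples of [x0] to these two inequalities. *)
Lemma graph_extend_one {G} (x0 : X) : linear_graph_below G ->
  exists2 G' : set (X * R), linear_graph_below G' &
    G `<=` G' /\ exists c, G' (x0, c).
Proof.
move=> GG; have [G0 GL Gp] := GG.
pose S := [set z.2 - p (z.1 - x0) | z in G].
have Sub y s : G (y, s) -> ubound S (p (y + x0) - s).
  move=> Gy _ [[x r] Gx <-] /=.
  have := Gp _ _ (GL 1 _ _ _ _ Gx Gy); rewrite scale1r mul1r => rs.
  have := p_subadd (x - x0) (y + x0); rewrite addrACA addNr addr0; lra.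
have Ssup : has_sup S.
  by split; [exists (0 - p (0 - x0)), (0, 0)|exists (p (0 + x0) - 0); exact: Sub].
pose c := sup S.
have c_ge x r : G (x, r) -> r - c <= p (x - x0).
  move=> Gx; have : r - p (x - x0) <= c.
    by apply: ub_le_sup; [case: Ssup|exists (x, r)].
  by lra.
have c_le x r : G (x, r) -> r + c <= p (x + x0).
  move=> Gx; have : c <= p (x + x0) - r.
    by apply: ge_sup; [case: Ssup|exact: Sub].
  by lra.
exists [set z | exists x r t, G (x, r) /\ z = (x + t *: x0, r + t * c)].
  split.
  - by exists 0, 0, 0; split; rewrite // scale0r mul0r !addr0.
  - move=> a _ _ _ _ [x [r [t [Gx [-> ->]]]]] [y [s [u [Gy [-> ->]]]]].
    exists (a *: x + y), (a * r + s), (a * t + u); split; first exact: GL.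
    congr (_, _); last by ring.
    by rewrite scalerDr scalerDl scalerA addrACA.
  - move=> _ _ [x [r [t [Gx [-> ->]]]]].
    have [t0|t0|->] := ltgtP t 0; last by rewrite scale0r mul0r !addr0; exact: Gp.
    + have t0' : 0 < - t by lra.
      have := c_ge _ _ (graph_scale (- t)^-1 _ _ GG Gx).
      rewrite -(ler_pM2l t0') -p_homog // scalerBr scalerA mulfV ?gt_eqF//.
      rewrite scale1r scaleNr opprK; apply: le_trans.
      by rewrite mulrBr mulVKf ?gt_eqF//; lra.
    + have := c_le _ _ (graph_scale t^-1 _ _ GG Gx).
      rewrite -(ler_pM2l t0) -p_homog // scalerDr scalerA mulfV ?gt_eqF//.
      by rewrite scale1r mulrDr mulVKf ?gt_eqF.
split; last by exists c, 0, 0, 1; rewrite scale1r mul1r !add0r.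
by move=> [x r] Gx; exists x, r, 0; rewrite scale0r mul0r !addr0.
Qed.

Lemma hahn_banach {G0} : linear_graph_below G0 ->
  exists F : X -> R,
    [/\ forall (a : R) x y, F (a *: x + y) = a * F x + F y,
        forall x, F x <= p x & forall x r, G0 (x, r) -> F x = r].
Proof.
move=> GG0.
have [|G [GG Gmax]] :=
    (* Joining [G0] inside the predicate makes the empty chain harmless: its union then yields [G0]
       instead of the empty graph. *)
    @Zorn_bigcup _ [set G | linear_graph_below (G `|` G0)].
  move=> /= F FP Ftot; have [Z L B] := GG0; split.
  - by right.
  - have pair z w : (\bigcup_(H in F) H `|` G0) z ->
        (\bigcup_(H in F) H `|` G0) w ->
        exists2 H, linear_graph_below H &
          [/\ H `<=` \bigcup_(H in F) H `|` G0, H z & H w].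
      have sub H : F H -> H `|` G0 `<=` \bigcup_(H in F) H `|` G0.
        by move=> FH; apply: setSU; exact: bigcup_sup.
      move=> [[H FH Hz]|zG] [[K FK Kw]|wG].
      + have [HK|KH] := Ftot _ _ FH FK.
          exists (K `|` G0); first exact: FP.
          by split; [exact: sub|left; exact: HK|left].
        exists (H `|` G0); first exact: FP.
        by split; [exact: sub|left|left; exact: KH].
      + exists (H `|` G0); first exact: FP.
        by split; [exact: sub|left|right].
      + exists (K `|` G0); first exact: FP.
        by split; [exact: sub|right|left].
      + by exists G0 => //; split => //; right.
    move=> a x y r s xr ys; have [H [_ HL _] [sH Hx Hy]] := pair _ _ xr ys.
    by apply: sH; exact: HL.
  - move=> x r [[H FH Hx]|]; last exact: B.
    by have [_ _] := FP _ FH; apply; left.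
have Gdom x : exists r, (G `|` G0) (x, r).
  have [G' GG' [sG [c Gc]]] := graph_extend_one x GG.
  exists c; apply: contrapT => nc; apply: (Gmax G'); last first.
    by rewrite /= (setUidl _)// => z ?; apply: sG; right.
  split; first by move=> z Gz; apply: sG; left.
  by move=> /(_ _ Gc) Gxc; apply: nc; left.
have [F FG] := choice Gdom; have [_ GL Gp] := GG.
exists F; split.
- by move=> a x y; apply: (graph_functional _ _ _ GG (FG _)); exact: GL.
- by move=> x; apply: Gp.
- by move=> x r G0x; apply: (graph_functional _ _ _ GG (FG _)); right.
Qed.

End HahnBanach.

Arguments linear_graph_below {R X} p G.

(** * Duality and weak compactness *)

Definition linear_subspace {R : realType} {X : lmodType R} (W : set X) : Prop :=
  W 0 /\ forall (a : R) x y, W x -> W y -> W (a *: x + y).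

Section Subspaces.
Context {R : realType} {X : lmodType R}.
Implicit Types (W : set X) (f : X -> R).

Lemma submod_closed_subspace W : submod_closed (mem W) -> linear_subspace W.
Proof.
case=> W0 WL; split; first by have := W0; rewrite inE.
by move=> a x y Wx Wy; have := WL a x y; rewrite !inE; exact.
Qed.

Lemma linear_subspaceZ {W} (a : R) x : linear_subspace W -> W x -> W (a *: x).
Proof. by case=> W0 WL Wx; rewrite -[a *: x]addr0; exact: WL. Qed.

Lemma linear_subspaceD {W} x y : linear_subspace W -> W x -> W y -> W (x + y).
Proof. by case=> W0 WL Wx Wy; rewrite -[x]scale1r; exact: WL. Qed.

Lemma linear_subspaceB {W} x y : linear_subspace W -> W x -> W y -> W (x - y).
Proof. by case=> W0 WL Wx Wy; rewrite addrC -scaleN1r; exact: WL. Qed.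

Lemma linear_subspaceT : linear_subspace [set: X].
Proof. by []. Qed.

End Subspaces.

Section Duality.
Context {R : realType} {X : normedModType R}.
Implicit Types (W V : set X) (f g : X -> R).

Lemma in_dualS W V f : W `<=` V -> in_dual V f -> in_dual W f.
Proof.
move=> WV [fL [C fC]]; split; first by move=> a x y /WV ? /WV ?; exact: fL.
by exists C => x /WV; exact: fC.
Qed.

Section InDual.
Context {W : set X} {f : X -> R}.
Hypotheses (WS : linear_subspace W) (fW : in_dual W f).

Lemma in_dual0 : f 0 = 0.
Proof.
have [[W0 _] [fL _]] := (WS, fW).
by have := fL 1 _ _ W0 W0; rewrite scale1r addr0; lra.
Qed.

Lemma in_dualZ (a : R) x : W x -> f (a *: x) = a * f x.
Proof.
have [[W0 _] [fL _]] := (WS, fW).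
by move=> Wx; rewrite -[a *: x]addr0 fL // in_dual0 addr0.
Qed.

Lemma in_dualD x y : W x -> W y -> f (x + y) = f x + f y.
Proof.
by have [fL _] := fW; move=> Wx Wy; rewrite -[x]scale1r fL // mul1r scale1r.
Qed.

Lemma in_dualB x y : W x -> W y -> f (x - y) = f x - f y.
Proof.
by have [fL _] := fW; move=> Wx Wy; rewrite addrC -scaleN1r fL // mulN1r addrC.
Qed.

End InDual.

Lemma in_dual_lin W (a : R) f g :
  in_dual W f -> in_dual W g -> in_dual W (fun x => a * f x + g x).
Proof.
move=> [fL [C fC]] [gL [D gD]]; split.
  by move=> b x y Wx Wy; rewrite fL // gL //; ring.
exists (`|a| * C + D) => x Wx; rewrite (le_trans (ler_normD _ _)) // mulrDl.
by rewrite normrM -mulrA lerD ?ler_wpM2l ?fC ?gD.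
Qed.

Lemma hahn_banach_norm {C : R} {G : set (X * R)} : 0 <= C ->
  linear_graph_below (fun x => C * `|x|) G ->
  exists F : X -> R, [/\ in_dual setT F, forall x, `|F x| <= C * `|x|
    & forall x r, G (x, r) -> F x = r].
Proof.
move=> C0 /hahn_banach[||F [FL Fp FG]].
- by move=> x y; rewrite -mulrDr ler_wpM2l ?ler_normD.
- by move=> a x a0; rewrite normrZ gtr0_norm // mulrCA.
have F0 : F 0 = 0 by have := FL 1 0 0; rewrite scale1r addr0; lra.
have FC x : `|F x| <= C * `|x|.
  have := Fp (- x); have := FL (-1) x 0; rewrite scaleN1r normrN addr0 => ->.
  by rewrite F0 ler_norml; have := Fp x; lra.
by exists F; split=> //; split; [move=> *; exact: FL|exists C].
Qed.

Lemma in_dual_extend {W} {f} : linear_subspace W -> in_dual W f ->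
  exists2 F, in_dual setT F & forall x, W x -> F x = f x.
Proof.
move=> WS fW; have [W0 WL] := WS; have [fL [C fC]] := fW.
(* The constant of [in_dual] may be negative, hence the absolute value. *)
have [||F [FT _ FG]] := @hahn_banach_norm `|C| [set z | W z.1 /\ z.2 = f z.1].
- by [].
- split; first by rewrite /= (in_dual0 WS fW).
    by move=> a x y r s [/= Wx ->] [/= Wy ->]; split; [exact: WL|rewrite fL].
  move=> x r [/= Wx ->]; apply: (le_trans (ler_norm _)).
  by apply: (le_trans (fC _ Wx)); rewrite ler_wpM2r ?ler_norm.
by exists F => // x Wx; exact: FG.
Qed.

Lemma norming_functional (x0 : X) : exists F : X -> R,
  [/\ in_dual setT F, forall x, `|F x| <= `|x| & F x0 = `|x0|].
Proof.
have [||F [FT F1 FG]] := @hahn_banach_norm 1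
  [set z | exists t, z = (t *: x0, t * `|x0|)].
- by [].
- split; first by exists 0; rewrite scale0r mul0r.
    move=> a _ _ _ _ [t [-> ->]] [u [-> ->]]; exists (a * t + u).
    by congr (_, _); [rewrite scalerDl scalerA|ring].
  move=> _ _ [t [-> ->]]; rewrite mul1r normrZ.
  by rewrite ler_wpM2r ?ler_norm.
exists F; split=> // [x|]; first by rewrite -[leRHS]mul1r.
by apply: FG; exists 1; rewrite scale1r mul1r.
Qed.

(** On the span of [x0] and [W], the functional [t *: x0 + w |-> t] is bounded by [e^-1], where [e]
    is the radius of a ball around [x0] that misses [W]; Hahn-Banach extends it. *)
Lemma closed_subspace_separation {W} {x0 : X} : linear_subspace W -> closed W ->
  ~ W x0 -> exists F, [/\ in_dual setT F, forall x, W x -> F x = 0 & F x0 = 1].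
Proof.
move=> WS Wcl nWx0; have [W0 WL] := WS.
have [e /= e0 xW] : exists2 e : R, 0 < e & forall w, W w -> e <= `|x0 + w|.
  have : nbhs x0 (~` W) by apply: open_nbhs_nbhs; split; [exact: closed_openC|].
  move=> /nbhs_ballP[e e0 eW]; exists e => // w Ww; rewrite leNgt; apply/negP.
  move=> xw; apply: (eW (- w)); last by rewrite -scaleN1r; exact: linear_subspaceZ.
  by rewrite -ball_normE /= opprK.
have [||F [FT _ FG]] := @hahn_banach_norm e^-1
  [set z | exists w t, W w /\ z = (t *: x0 + w, t)].
- by rewrite invr_ge0 ltW.
- split; first by exists 0, 0; rewrite scale0r addr0.
    move=> a _ _ _ _ [w [t [Ww [-> ->]]]] [v [u [Wv [-> ->]]]].
    exists (a *: w + v), (a * t + u); split; first exact: WL.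
    by congr (_, _); rewrite scalerDl scalerDr scalerA addrACA.
  move=> _ _ [w [t [Ww [-> ->]]]]; rewrite mulrC ler_pdivlMr //.
  have [->|t0] := eqVneq t 0; first by rewrite mul0r.
  have := xW _ (linear_subspaceZ t^-1 _ WS Ww).
  rewrite -(ler_pM2l (_ : 0 < `|t|)) ?normr_gt0 // -normrZ scalerDr scalerA.
  rewrite divff // scale1r; apply: le_trans.
  by rewrite ler_wpM2r ?ler_norm // ltW.
exists F; split=> //; last by apply: FG; exists 0, 1; rewrite scale1r addr0.
by move=> x Wx; apply: FG; exists x, 0; rewrite scale0r add0r.
Qed.

Lemma le_dual_norm {W f} x : in_dual W f -> W x -> `|x| <= 1 ->
  `|f x| <= dual_norm W f.
Proof.
move=> [_ [C fC]] Wx x1; apply: ub_le_sup; last by exists x.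
exists `|C| => _ [y [Wy y1] <-]; apply: (le_trans (fC _ Wy)).
rewrite (le_trans (ler_norm _)) // normrM normr_id.
by rewrite -[leRHS]mulr1 ler_wpM2l.
Qed.

Lemma dual_norm_bound {W f} x : linear_subspace W -> in_dual W f -> W x ->
  `|f x| <= `|x| * dual_norm W f.
Proof.
move=> WS fW Wx; have [->|x0] := eqVneq x 0.
  by rewrite (in_dual0 WS fW) !normr0 mul0r.
have nx0 : 0 < `|x| by rewrite normr_gt0.
have := @le_dual_norm W f (`|x|^-1 *: x) fW (linear_subspaceZ _ _ WS Wx).
rewrite normrZ normfV normr_id mulVf ?gt_eqF // lexx => /(_ isT).
rewrite (in_dualZ WS fW) // normrM normfV normr_id.
by rewrite ler_pdivrMl.
Qed.

Lemma in_bidual_eval {W} x : linear_subspace W -> W x -> in_bidual W (fun f => f x).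
Proof.
by move=> WS Wx; split=> //; exists `|x| => f fW; exact: dual_norm_bound.
Qed.

(** Compactness of [[-C, C]] gives a cluster point, and an ultrafilter converges to each of its
    cluster points. *)
Lemma ultra_bounded_cvg {I : Type} {U : set_system I} {UU : UltraFilter U}
    {u : I -> R} {C : R} :
  (\forall i \near U, `|u i| <= C) -> cvg (u i @[i --> U]).
Proof.
move=> uC; have := @segment_compact R (- C) C (u @ U).
case; first by apply: filterS uC => i; rewrite /= in_itv /= -ler_norml.
move=> l [_ lU]; apply/cvg_ex; exists l => N Nl.
have [//|nN] := in_ultra_setVsetC (u @^-1` N) UU.
by have [z [/= nNz]] := lU (~` N) N nN Nl.
Qed.

(** The limits of [f (u i)] along [U] define a bounded functional [phi] of [f], which reflexivity
    represents by a point [x]. Separation keeps [x] in [W], and a norming functional of [x] keeps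
    its norm below [r]. *)
Lemma weakly_compact_ball {W} {I : Type} {U : set_system I}
    {UU : UltraFilter U} {u : I -> X} {r : R} :
  reflexive_space X -> linear_subspace W -> closed W ->
  (\forall i \near U, W (u i) /\ `|u i| <= r) ->
  exists x, [/\ W x, `|x| <= r & weak_cvg U u x].
Proof.
move=> Xrefl WS Wcl uWr.
pose phi f := lim (f (u i) @[i --> U]).
have u_bound f : in_dual setT f ->
    \forall i \near U, `|f (u i)| <= r * dual_norm setT f.
  move=> fT; apply: filterS uWr => i [_ ur].
  apply: (le_trans (dual_norm_bound _ linear_subspaceT fT _)) => //.
  rewrite ler_wpM2r //; have := @le_dual_norm setT f 0 fT.
  by rewrite normr0 => /(_ Logic.I ler01); apply: le_trans.
have phi_cvg f : in_dual setT f -> f (u i) @[i --> U] --> phi f.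
  by move=> /u_bound; exact: ultra_bounded_cvg.
have [x phix] : exists x : X, forall f, in_dual setT f -> phi f = f x.
  apply: Xrefl; split.
    move=> a f g fT gT; apply: cvg_lim => //.
    by apply: cvgD (phi_cvg _ gT); apply: cvgMr; exact: phi_cvg.
  exists r => f fT.
  have : `|f (u i)| @[i --> U] --> `|phi f| by apply: cvg_norm; exact: phi_cvg.
  by apply: (closed_cvg _ (@closed_le _ _)); exact: u_bound.
have xU : weak_cvg U u x by move=> f fT; rewrite -phix //; exact: phi_cvg.
exists x; split=> //.
- apply: contrapT => /(closed_subspace_separation WS Wcl)[F [FT FW Fx]].
  have : F (u i) @[i --> U] --> (0 : R).
    by apply: cvg_near_cst; apply: filterS uWr => i [/FW].
  move=> /(cvg_lim (@norm_hausdorff _ _)) F0.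
  have /(cvg_lim (@norm_hausdorff _ _)) := xU _ FT.
  by rewrite F0 Fx => /esym/eqP; rewrite oner_eq0.
- have [F [FT F1 <-]] := norming_functional x.
  apply: (closed_cvg _ (@closed_le _ _)) (xU _ FT).
  by apply: filterS uWr => i [_]; apply: le_trans; exact: le_trans (ler_norm _) (F1 _).
Qed.

End Duality.

(** * Affine functions on convex sets *)

Section Alternative.
Context {R : realType} {X : lmodType R}.
Implicit Types (C : set X) (g h : X -> R).

Definition convex_subset C : Prop := forall (t : R) x y,
  0 <= t <= 1 -> C x -> C y -> C (t *: x + (1 - t) *: y).

Definition affine_on C g : Prop := forall (t : R) x y, 0 <= t <= 1 ->
  C x -> C y -> g (t *: x + (1 - t) *: y) = t * g x + (1 - t) * g y.

(** Up to a positive factor, [h x * g y - h y * g x] is the value of [h] where [g] vanishes on the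
    segment from [x] to [y]. Were it positive, a nearby point of the segment would have both [g] and
    [h] positive. *)
Lemma affine_sign {C g h} x y : convex_subset C -> affine_on C g ->
  affine_on C h -> (forall x, C x -> 0 < g x -> h x <= 0) ->
  C x -> C y -> g x <= 0 -> 0 < g y -> h x * g y <= h y * g x.
Proof.
move=> CC gA hA gh Cx Cy gx gy; have hy := gh _ Cy gy.
(* The hypothesis [gh] on the segment, with weights that need not sum to 1. *)
have comb a b : 0 <= a -> 0 < b -> 0 < a * g y + b * g x ->
    a * h y + b * h x <= 0.
  move=> a0 b0; have ab0 : 0 < a + b by lra.
  have t01 : 0 <= a / (a + b) <= 1.
    by rewrite divr_ge0 ?(ltW ab0) //= ler_pdivrMr //; lra.
  have bE : 1 - a / (a + b) = b / (a + b) by field; rewrite gt_eqF.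
  have scaled u v : a / (a + b) * u + (1 - a / (a + b)) * v
      = (a * u + b * v) / (a + b) by rewrite bE; ring.
  have := gh _ (CC _ _ _ t01 Cy Cx).
  by rewrite gA // hA // !scaled pmulr_lgt0 ?invr_gt0 // pmulr_lle0 ?invr_gt0.
rewrite leNgt; apply/negP => D0.
have hx : 0 < h x.
  rewrite ltNge; apply/negP => hx; move: D0; apply/negP; rewrite -leNgt.
  by rewrite (@le_trans _ _ 0) ?mulr_le0_ge0 ?mulr_le0 // ltW.
(* With these weights both combinations equal [h x * g y - h y * g x]. *)
have := comb (h x - g x) (g y - h y).
have -> : (h x - g x) * g y + (g y - h y) * g x = h x * g y - h y * g x by ring.
have -> : (h x - g x) * h y + (g y - h y) * h x = h x * g y - h y * g x by ring.
lra.
Qed.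

(** The multiplier is the infimum of [- h / g] over the points where [g] is positive. It is the
    largest value that works at those points, and [affine_sign] shows that it is large enough where
    [g] is negative. *)
Lemma affine_multiplier {C g h} : convex_subset C -> affine_on C g ->
  affine_on C h -> (exists2 x, C x & 0 < g x) ->
  (forall x, C x -> 0 < g x -> h x <= 0) ->
  exists2 l, 0 <= l & forall x, C x -> h x + l * g x <= 0.
Proof.
move=> CC gA hA [x0 Cx0 gx0] gh.
pose S := [set - h x / g x | x in [set x | C x /\ 0 < g x]].
have S_lb x : C x -> 0 < g x -> inf S <= - h x / g x.
  move=> Cx gx; apply: ge_inf; last by exists x.
  by exists 0 => _ [y [Cy gy] <-]; rewrite divr_ge0 ?oppr_ge0 ?gh ?(ltW gy).
have le_S c : lbound S c -> c <= inf S by apply: lb_le_inf; exists (- h x0 / g x0), x0.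
exists (inf S).
  by apply: le_S => _ [y [Cy gy] <-]; rewrite divr_ge0 ?oppr_ge0 ?gh ?(ltW gy).
move=> x Cx; have [gx|gx|gx] := ltgtP (g x) 0.
- suff : h x / - g x <= inf S by rewrite ler_pdivrMr ?oppr_gt0 //; lra.
  apply: le_S => _ [y [Cy gy] <-].
  rewrite ler_pdivrMr ?oppr_gt0 // mulrAC ler_pdivlMr //.
  by rewrite mulrNN; exact: affine_sign CC gA hA gh Cx Cy (ltW gx) gy.
- by have := S_lb _ Cx gx; rewrite ler_pdivlMr //; lra.
- have gx' : g x <= 0 by rewrite gx.
  have := affine_sign x x0 CC gA hA gh Cx Cx0 gx' gx0.
  by rewrite gx !mulr0 pmulr_lle0 // addr0.
Qed.

(** Induction on [n] with [C] varying: the first [n] functions are treated on the part of [C] where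
    [g n] is positive, and [affine_multiplier] then supplies the weight of [g n] that extends the
    inequality to all of [C]. *)
Lemma affine_alternative {C} n (g : nat -> X -> R) : convex_subset C ->
  (exists x, C x) -> (forall i, (i < n)%N -> affine_on C (g i)) ->
  ~ (exists2 x, C x & forall i, (i < n)%N -> 0 < g i x) ->
  exists q : nat -> R, [/\ forall i, 0 <= q i, \sum_(i < n) q i = 1
    & forall x, C x -> \sum_(i < n) q i * g i x <= 0].
Proof.
move=> CC C0 gA Cg; suff [q [q0 qs qC]] : exists q : nat -> R,
    [/\ forall i, 0 <= q i, 0 < \sum_(i < n) q i
      & forall x, C x -> \sum_(i < n) q i * g i x <= 0].
  exists (fun i => q i / \sum_(i < n) q i); split=> [i||x Cx].
  - by rewrite divr_ge0 // ltW.
  - by rewrite -mulr_suml divff // gt_eqF.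
  - under eq_bigr do rewrite mulrAC.
    by rewrite -mulr_suml pmulr_lle0 ?invr_gt0 // qC.
elim: n C CC C0 gA Cg => [|n IHn] C CC [x0 Cx0] gA Cg.
  by exfalso; apply: Cg; exists x0.
(* If [g n] is nowhere positive on [C], all the weight goes to [g n]. *)
have [[x1 [Cx1 gx1]]|nC'] := pselect (exists x, C x /\ 0 < g n x); last first.
  exists (fun i => (i == n)%:R); split=> [i||x Cx].
  - by rewrite ler0n.
  - by rewrite (bigD1 ord_max) //= eqxx ltr_pwDl // sumr_ge0.
  - rewrite big_ord_recr /= eqxx mul1r big1 ?add0r => [|i _].
      by rewrite leNgt; apply/negP => gx; apply: nC'; exists x.
    by rewrite ltn_eqF // mul0r.
have [||||q [q0 qs qC]] := IHn [set x | C x /\ 0 < g n x].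
- move=> t x y t01 [Cx gx] [Cy gy]; split; first exact: CC.
  rewrite gA //; have [->|t0] := eqVneq t 0; first by rewrite mul0r subr0; lra.
  have tpos : 0 < t by rewrite lt_neqAle eq_sym t0; case/andP: t01.
  by rewrite ltr_pwDl ?mulr_gt0 // mulr_ge0 ?(ltW gy) // subr_ge0; case/andP: t01.
- by exists x1.
- by move=> i ltin t x y t01 [Cx _] [Cy _]; apply: gA => //; exact: ltnW.
- move=> [x [Cx gx] gix]; apply: Cg; exists x => // i.
  by rewrite ltnS leq_eqVlt => /predU1P[->|/gix].
have [||||l l0 lC] := @affine_multiplier C (g n) (fun x => \sum_(i < n) q i * g i x) CC.
- exact: gA.
- move=> t x y t01 Cx Cy; rewrite !mulr_sumr -big_split /=; apply: eq_bigr => i _.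
  by rewrite (gA i (ltnW (ltn_ord i))) //; ring.
- by exists x1.
- by move=> x Cx gx; exact: qC.
exists (fun i => if i == n then l else q i).
have E (G : nat -> R) :
    \sum_(i < n) (if i == n :> nat then l else q i) * G i = \sum_(i < n) q i * G i.
  by apply: eq_bigr => i _; rewrite ltn_eqF.
split=> [i||x Cx]; first by case: ifP.
- rewrite big_ord_recr /= eqxx; rewrite (eq_bigr (fun i : 'I_n => q i)) ?ltr_wpDr // => i _.
  by rewrite ltn_eqF.
- by rewrite big_ord_recr /= eqxx (E (g ^~ x)) lC.
Qed.

End Alternative.

(** * The Browder-Minty theorem *)

Section BrowderMinty.
Context {R : realType} {X : normedModType R}.
Implicit Types (W : set X) (T : X -> X -> R).

Definition ball_in W (r : R) : set X := [set x | W x /\ `|x| <= r].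

Lemma ball_in_comb {W} {r : R} {q : nat -> R} {y : nat -> X} n : linear_subspace W ->
  (forall i, 0 <= q i) -> (forall i, (i < n)%N -> ball_in W r (y i)) ->
  W (\sum_(i < n) q i *: y i) /\
  `|\sum_(i < n) q i *: y i| <= (\sum_(i < n) q i) * r.
Proof.
move=> WS q0; elim: n => [|n IHn] yW.
  by have [W0 _] := WS; rewrite !big_ord0 normr0 mul0r.
have [i /leqW/yW//|Ws ns] := IHn.
have [Wn nn] := yW n (leqnn _); rewrite !big_ord_recr /=; split.
  by apply: linear_subspaceD => //; exact: linear_subspaceZ.
rewrite (le_trans (ler_normD _ _)) // mulrDl lerD // normrZ ger0_norm //.
by rewrite ler_wpM2l.
Qed.

Lemma in_dual_comb {W} {r : R} {f : X -> R} {q : nat -> R} {y : nat -> X} n :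
  linear_subspace W -> in_dual W f ->
  (forall i, 0 <= q i) -> (forall i, (i < n)%N -> ball_in W r (y i)) ->
  f (\sum_(i < n) q i *: y i) = \sum_(i < n) q i * f (y i).
Proof.
move=> WS fW q0; elim: n => [|n IHn] yW.
  by rewrite !big_ord0 (in_dual0 WS fW).
have yW' i : (i < n)%N -> ball_in W r (y i) by move=> /leqW; exact: yW.
have [Ws _] := ball_in_comb n WS q0 yW'; have [Wn _] := yW n (leqnn _).
rewrite !big_ord_recr /= (in_dualD fW) //; last exact: linear_subspaceZ.
by rewrite IHn // (in_dualZ WS fW).
Qed.

(* The multipliers [q] of the alternative would make the convex combination
   [\sum_i q i *: y i] contradict monotonicity. *)
Lemma monotone_finite_approx {W} {r e : R} n {y : nat -> X} {F : nat -> X -> R} :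
  linear_subspace W -> 0 < e -> 0 <= r ->
  (forall i, (i < n)%N -> ball_in W r (y i)) ->
  (forall i, (i < n)%N -> in_dual W (F i)) ->
  (forall i j, (i < n)%N -> (j < n)%N ->
     0 <= F i (y i - y j) - F j (y i - y j)) ->
  exists2 x, ball_in W r x & forall i, (i < n)%N -> - e < F i (y i - x).
Proof.
move=> WS e0 r0 yW FW Fmon; have [W0 WL] := WS.
apply: contrapT => nx.
have [||||q [q0 q1 qC]] :=
  @affine_alternative R X (ball_in W r) n (fun i x => F i (y i - x) + e).
- move=> t x z /andP[t0 t1] [Wx nx'] [Wz nz]; split.
    by apply: WL => //; exact: linear_subspaceZ.
  rewrite (le_trans (ler_normD _ _)) // !normrZ !ger0_norm ?subr_ge0 //.
  have t1' : 0 <= 1 - t by lra.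
  by have := ler_wpM2l t0 nx'; have := ler_wpM2l t1' nz; lra.
- by exists 0; split; rewrite ?normr0.
- move=> i ltin t x z _ [Wx _] [Wz _]; have [Wy _] := yW _ ltin.
  rewrite !(in_dualB (FW _ ltin)) //; last by apply: WL => //; exact: linear_subspaceZ.
  rewrite (in_dualD (FW _ ltin)) ?(in_dualZ WS (FW _ ltin)) //; first ring.
  + exact: linear_subspaceZ.
  + exact: linear_subspaceZ.
- move=> [x Kx gx]; apply: nx; exists x => // i /gx; lra.
have [Ws] := ball_in_comb n WS q0 yW; rewrite q1 mul1r => ns.
have := qC _ (conj Ws ns); apply/negP; rewrite -ltNge.
(* At the combination of the [y i], the weighted sum is the double sum of [m] plus [e];
   nonnegativity of the double sum thus contradicts the alternative. *)
pose m (i j : 'I_n) := q i * q j * F i (y i - y j).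
have -> : \sum_(i < n) q i * (F i (y i - \sum_(j < n) q j *: y j) + e)
        = \sum_(i < n) \sum_(j < n) m i j + e.
  under eq_bigr do rewrite mulrDr; rewrite big_split /= -mulr_suml q1 mul1r.
  congr (_ + e); apply: eq_bigr => i _.
  have [Wy _] := yW i (ltn_ord i); have FWi := FW i (ltn_ord i).
  rewrite (in_dualB FWi) // (in_dual_comb n WS FWi q0 yW).
  rewrite -[F i (y i)]mul1r -q1 mulr_suml -sumrB mulr_sumr.
  apply: eq_bigr => j _; have [Wyj _] := yW j (ltn_ord j).
  by rewrite /m (in_dualB FWi) //; ring.
rewrite ltr_wpDl //.
(* After symmetrisation each term is [q i * q j] times a monotonicity expression, so twice the
   double sum is nonnegative. *)
have : 0 <= \sum_(i < n) \sum_(j < n) (m i j + m j i).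
  apply: sumr_ge0 => i _; apply: sumr_ge0 => j _; rewrite /m.
  rewrite (mulrC (q j)) -mulrDr mulr_ge0 ?mulr_ge0 //.
  have [Wy _] := yW i (ltn_ord i); have [Wyj _] := yW j (ltn_ord j).
  have := Fmon _ _ (ltn_ord i) (ltn_ord j).
  rewrite !(in_dualB (FW i (ltn_ord i))) // !(in_dualB (FW j (ltn_ord j))) //; lra.
under eq_bigr do rewrite big_split /=; rewrite big_split /=.
by rewrite [X in _ + X]exchange_big /=; lra.
Qed.

(** The approximate solutions for finitely many test points and a tolerance form a filter base. The
    weak limit of an ultrafilter containing it satisfies every inequality exactly, since each is
    affine in the unknown. *)
Lemma monotone_weak_inequality {W} {r : R} {T} : reflexive_space X ->
  linear_subspace W -> closed W -> 0 <= r -> (forall x, W x -> in_dual W (T x)) ->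
  monotone_on W T ->
  exists2 x, ball_in W r x & forall y, ball_in W r y -> 0 <= T y (y - x).
Proof.
move=> Xrefl WS Wcl r0 TW Tmon; have [W0 WL] := WS.
pose D := [set d : seq X * R | 0 < d.2 /\ forall y, y \in d.1 -> ball_in W r y].
pose B (d : seq X * R) := [set x | ball_in W r x /\
  forall y, y \in d.1 -> - d.2 < T y (y - x)].
have BP : ProperFilter (filter_from D B).
  apply: filter_from_proper; first apply: filter_from_filter.
  - by exists ([::], 1); split.
  - move=> [s d] [t e] [/= d0 sK] [/= e0 tK].
    exists (s ++ t, Num.min d e).
      split; first by rewrite /= lt_min d0.
      by move=> y; rewrite mem_cat => /orP[/sK|/tK].
    move=> x [Kx xst]; have [md me] : Num.min d e <= d /\ Num.min d e <= e.
      by split; rewrite ge_min lexx ?orbT.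
    split; split=> // y ys; have := xst y.
      by rewrite mem_cat ys => /(_ isT) /=; lra.
    by rewrite mem_cat ys orbT => /(_ isT) /=; lra.
  - move=> [s e] [/= e0 sK].
    have sK' i : (i < size s)%N -> ball_in W r (nth 0 s i).
      by move=> lti; apply: sK; exact: mem_nth.
    have [||x Kx xs] :=
      @monotone_finite_approx W r e (size s) (nth 0 s) (fun i => T (nth 0 s i)) WS e0 r0 sK'.
    + by move=> i /sK'[Wy _]; exact: TW.
    + by move=> i j /sK'[Wi _] /sK'[Wj _]; exact: Tmon.
    exists x; split=> // y ys; rewrite -(nth_index 0 ys).
    by apply: xs; rewrite index_mem.
have [U [UU BU]] := ultraFilterLemma BP.
(* The ultrafilter lives on [X] itself, so the bounded family is the identity. *)
have [|x [Wx xr xU]] := @weakly_compact_ball R X W X U UU id r Xrefl WS Wcl.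
  by apply: BU; exists ([::], 1) => // x [].
exists x => // y [Wy yr].
(* Weak convergence is tested by functionals on all of [X], so [T y] is first extended from [W]. *)
have [F FT FE] := in_dual_extend WS (TW _ Wy).
rewrite (in_dualB (TW _ Wy)) // subr_ge0; apply/ler_addgt0Pr => e e0.
rewrite -FE //; apply: (closed_cvg _ (@closed_le _ _)) (xU _ FT).
apply: BU; exists ([:: y], e).
  by split=> //= z; rewrite inE => /eqP ->.
move=> z [[Wz zr] /(_ y)]; rewrite inE eqxx => /(_ isT) /=.
by rewrite FE // (in_dualB (TW _ Wy)) //; lra.
Qed.

(** Minty's trick: test with [x + t *: (y - x)], divide by [t] and let [t] tend to 0 from the right.
    Evaluation at [y - x] lies in the bidual, so hemicontinuity gives the limit. *)
Lemma minty {W} {r : R} {T x} : linear_subspace W ->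
  (forall x, W x -> in_dual W (T x)) -> hemicontinuous_on W T ->
  ball_in W r x -> (forall y, ball_in W r y -> 0 <= T y (y - x)) ->
  forall y, ball_in W r y -> 0 <= T x (y - x).
Proof.
move=> WS TW Them [Wx xr] xT y [Wy yr].
have Wyx := linear_subspaceB _ _ WS Wy Wx.
have := Them _ _ Wx Wyx _ (in_bidual_eval _ WS Wyx).
apply: (closed_cvg _ (@closed_ge _ _)).
near=> t; have t0 : 0 < t by near: t; exact: nbhs_right_gt.
have t1 : t <= 1 by near: t; exact: nbhs_right_le.
have Wz : W (x + t *: (y - x)) by apply: linear_subspaceD => //; exact: linear_subspaceZ.
have : 0 <= T (x + t *: (y - x)) (x + t *: (y - x) - x).
  apply: xT; split=> //.
  have -> : x + t *: (y - x) = (1 - t) *: x + t *: y.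
    by rewrite scalerBr scalerBl scale1r addrA addrAC.
  rewrite (le_trans (ler_normD _ _)) // !normrZ !ger0_norm ?subr_ge0 ?(ltW t0) //.
  have t1' : 0 <= 1 - t by lra.
  by have := ler_wpM2l (ltW t0) yr; have := ler_wpM2l t1' xr; lra.
rewrite addrAC subrr add0r (in_dualZ WS (TW _ Wz)) //.
by rewrite pmulr_rge0.
Unshelve. all: by end_near. Qed.

Theorem browder_minty {W} {r : R} {T} : reflexive_space X ->
  linear_subspace W -> closed W -> 0 <= r -> (forall x, W x -> in_dual W (T x)) ->
  monotone_on W T -> hemicontinuous_on W T ->
  (forall x, W x -> r < `|x| -> 0 < T x x) ->
  exists2 x, ball_in W r x & forall y, W y -> T x y = 0.
Proof.
move=> Xrefl WS Wcl r0 TW Tmon Them Tcoer; have [W0 WL] := WS.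
(* The larger ball leaves room: coercivity will force the solution into radius [r], and it can then
   be moved in every direction. *)
have r1 : 0 <= r + 1 by lra.
have [x Kx xT] := monotone_weak_inequality Xrefl WS Wcl r1 TW Tmon.
have xT' := minty WS TW Them Kx xT.
have [Wx _] := Kx; have TWx := TW _ Wx.
(* Testing with [y = 0] gives [T x x <= 0], which coercivity excludes beyond radius [r]. *)
have xr : `|x| <= r.
  rewrite leNgt; apply/negP => /(Tcoer _ Wx).
  have K0 : ball_in W (r + 1) 0 by split; rewrite ?normr0.
  by have := xT' _ K0; rewrite (in_dualB TWx) // (in_dual0 WS TWx); lra.
exists x => // y Wy.
(* The factor [(1 + |z|)^-1] makes the displacement shorter than 1, so the test point stays in the
   ball of radius [r + 1]. *)
have Tge z : W z -> 0 <= T x z.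
  move=> Wz; have z1 : 0 < 1 + `|z| by rewrite ltr_pwDl.
  have := xT' (x + (1 + `|z|)^-1 *: z).
  rewrite addrAC subrr add0r (in_dualZ WS TWx) // pmulr_rge0 ?invr_gt0 //.
  apply; split; first by apply: linear_subspaceD => //; exact: linear_subspaceZ.
  rewrite (le_trans (ler_normD _ _)) // lerD // normrZ gtr0_norm ?invr_gt0 //.
  by rewrite mulrC ler_pdivrMr // mul1r; lra.
have := Tge _ Wy; have := Tge _ (linear_subspaceB _ _ WS W0 Wy).
by rewrite (in_dualB TWx) // (in_dual0 WS TWx); lra.
Qed.

End BrowderMinty.

(** * Solutions along a directed family *)

Section MonotoneSolvability.
Context {R : realType} {X : normedModType R}.
Implicit Types (W : set X) (A : X -> X -> R).

Corollary monotone_solvable {W} {r : R} {A} {f : X -> R} : reflexive_space X ->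
  linear_subspace W -> closed W -> 0 <= r ->
  (forall x, W x -> in_dual W (A x)) -> in_dual W f ->
  monotone_on W A -> hemicontinuous_on W A ->
  (forall x, W x -> r < `|x| -> f x < A x x) ->
  exists2 x, ball_in W r x & forall y, W y -> A x y = f y.
Proof.
move=> Xrefl WS Wcl r0 AW fW Amon Ahem Acoer.
have [||||x Kx xf] := @browder_minty R X W r (fun x y => -1 * f y + A x y) Xrefl WS Wcl r0.
- by move=> x Wx; apply: in_dual_lin => //; exact: AW.
- by move=> x y Wx Wy; have := Amon _ _ Wx Wy; lra.
- move=> x y Wx Wy phi phiW; have [phiL _] := phiW.
  rewrite phiL //; last exact: AW.
  under eq_fun => t.
    rewrite phiL //; last by apply/AW/linear_subspaceD => //; exact: linear_subspaceZ.
    over.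
  by apply: cvgD; [exact: cvg_cst|exact: Ahem].
- by move=> x Wx /(Acoer _ Wx); lra.
exists x => // y /xf; lra.
Qed.

Lemma coercive_on_gt {V : set X} {A} (C : R) : coercive_on V A ->
  exists2 r : R, 0 <= r & forall x, V x -> r < `|x| -> C * `|x| < A x x.
Proof.
move=> /(_ [set z | C < z] (nbhs_pinfty_gt (num_real C)))[r _ rP].
(* The maximum with 0 forces [x] to be nonzero, so that the quotient can be cleared. *)
exists (Num.max r 0) => [|x Vx]; first by rewrite le_max lexx orbT.
rewrite gt_max => /andP[rx x0]; have := rP x rx Vx.
by rewrite /= ltr_pdivlMr.
Qed.

Lemma linear_subspace_bigcup {I : Type} {le : I -> I -> Prop} {W : I -> set X} :
  directed le -> (forall i, linear_subspace (W i)) ->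
  (forall i j, le i j -> W i `<=` W j) -> linear_subspace (\bigcup_i W i).
Proof.
move=> [[i0] _ _ ub] WS Wle; split; first by exists i0 => //; case: (WS i0).
move=> a x y [i _ Wx] [j _ Wy]; have [k [ik jk]] := ub i j.
exists k => //; have [_ WL] := WS k.
by apply: WL; [exact: Wle Wx|exact: Wle Wy].
Qed.

End MonotoneSolvability.

Lemma tails_proper {I : Type} {le : I -> I -> Prop} :
  directed le -> ProperFilter (tails le).
Proof.
move=> [[i0] le_refl le_trans ub].
apply: filter_from_proper; last by move=> i _; exists i; exact: le_refl.
apply: filter_from_filter; first by exists i0.
move=> i j _ _; have [k [ik jk]] := ub i j; exists k => // l kl.
by split; [exact: le_trans kl|exact: le_trans kl].
Qed.

(** * Nets generating a given filter *)

Section FilterNet.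
Context {I : Type} (U : set_system I).

(* Type M quantifies over nets, whereas weak compactness is obtained along an
   ultrafilter: the net [point] converges wherever the filter [U] does. *)
Definition pointed : Type := {p : set I * I | U p.1 /\ p.1 p.2}.
Definition pointed_le (p q : pointed) : Prop := (sval q).1 `<=` (sval p).1.
Definition point (p : pointed) : I := (sval p).2.

Context {UF : ProperFilter U}.

Lemma pointed_directed : directed pointed_le.
Proof.
have mk S : U S -> exists p : pointed, (sval p).1 = S.
  move=> US; have [i Si] := filter_ex US.
  by exists (exist _ (S, i) (conj US Si)).
split.
- by have [p _] := mk _ filterT; exists.
- by move=> p.
- by move=> p q r pq qr; exact: subset_trans qr pq.
- move=> [[S i] [US Si]] [[T j] [UT Tj]].
  have [p pE] := mk _ (filterI US UT); exists p.
  by rewrite /pointed_le pE; split=> z [].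
Qed.

Lemma point_tails : point @ tails pointed_le --> U.
Proof.
move=> S US; have [i Si] := filter_ex US.
exists (exist _ (S, i) (conj US Si)) => // -[[T j] [/= UT Tj]] /= TS.
exact: TS.
Qed.

End FilterNet.

Theorem theorem3p3 (R : realType) (X : completeNormedModType R)
  (X_reflexive : reflexive_space X)
  (Lambda : Type) (le : Lambda -> Lambda -> Prop) (le_directed : directed le)
  (Xl : Lambda -> set X)
  (Xl_subspace : forall l, submod_closed (mem (Xl l)))
  (Xl_closed : forall l, closed (Xl l))
  (Xl_directed : forall l m, le l m -> Xl l `<=` Xl m)
  (V : set X) (V_def : V = \bigcup_l Xl l)
  (A : X -> X -> R)
  (A_type_M : type_M V A)
  (A_coercive : coercive_on V A)
  (A_dual : forall l x, Xl l x -> in_dual (Xl l) (A x))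
  (A_monotone : forall l, monotone_on (Xl l) A)
  (A_hemicontinuous : forall l, hemicontinuous_on (Xl l) A)
  (vs : X -> R) (vs_dual : in_dual V vs) :
  exists x : X, forall v, V v -> A x v = vs v.
Proof.
have XS l := submod_closed_subspace _ (Xl_subspace l).
have XV l : Xl l `<=` V by rewrite V_def; exact: bigcup_sup.
have VS : linear_subspace V.
  by rewrite V_def; exact: linear_subspace_bigcup le_directed XS Xl_directed.
have [F FT FE] := in_dual_extend VS vs_dual.
have [_ [C vsC]] := vs_dual.
(* With [C] bounding [vs], coercivity gives [vs x < A x x] beyond a radius [r] that is the same for
   every [Xl l]. *)
have [r r0 Ar] := coercive_on_gt C A_coercive.
have /choice[u uP] l :
    exists x, ball_in (Xl l) r x /\ forall y, Xl l y -> A x y = vs y.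
  have [||x] := @monotone_solvable R X (Xl l) r A vs X_reflexive (XS l)
    (Xl_closed l) r0 (A_dual l) _ (A_monotone l) (A_hemicontinuous l).
  - exact: in_dualS vs_dual.
  - move=> x /XV Vx rx; apply: le_lt_trans (Ar _ Vx rx).
    exact: le_trans (ler_norm _) (vsC _ Vx).
  - by exists x.
(* By directedness, a fixed [v] in [Xl l] is a valid test vector for all later solutions. *)
have u_sol v : V v -> \forall l \near tails le, A (u l) v = vs v.
  rewrite V_def => -[l _ Xv]; exists l => // m lm.
  by have [_] := uP m; apply; exact: Xl_directed Xv.
have [U [UU leU]] := ultraFilterLemma (tails_proper le_directed).
(* [V] need not be closed, so the weak limit is taken in the whole space. *)
have [|x [_ _ xU]] := @weakly_compact_ball R X setT _ U UU u r X_reflexive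
    linear_subspaceT closedT.
  by apply: filterE => l; have [[_ ur] _] := uP l.
have net (g : Lambda -> R) (a : R) : g l @[l --> U] --> a ->
    g (point U i) @[i --> tails (pointed_le U)] --> a.
  exact: (cvg_comp _ _ (point_tails U)).
exists x; apply: (A_type_M _ _ (pointed_directed U) (u \o point U) _ x vs F).
- by move=> i; apply: (XV (point U i)); have [[]] := uP (point U i).
- exact: vs_dual.
- by split=> //; exact: in_dualS FT.
- by move=> f fT; exact: net (xU _ fT).
- move=> v Vv; apply: (net (fun l => A (u l) v)).
  by apply: cvg_near_cst; exact: leU _ (u_sol _ Vv).
- apply: (net (fun l => A (u l) (u l))).
  (* Each [u l] is a valid test vector for its own equation, which turns the quadratic term into the
     functional [F], where weak convergence applies. *)
  have -> : (fun l => A (u l) (u l)) = (fun l => F (u l)).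
    apply/funext => l; have [[Xu _] ->] := uP l; last exact: Xu.
    by rewrite FE //; exact: XV Xu.
  exact: xU.
Qed.
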